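(* Assume that $F$ is $\mu$-strongly convex with $\mu>0$, that $f(\cdot;\xi)$ is $L$-smooth for every realization of $\xi$, and that $f(\cdot;\xi)$ is convex for every realization of $\xi$. Let $w_*$ be the unique minimizer of $F$. Consider the SGD iteration $w_{t+1}=w_t-\eta_t\nabla f(w_t;\xi_t)$, $t\ge 0$, with a stepsize sequence such that $$0<\eta_t\le \frac{1}{2L}\ \text{ for all } t\ge 0,\qquad \sum_{t=0}^\infty \eta_t=\infty,\qquad \sum_{t=0}^\infty\eta_t^2<\infty .$$ Then, with probability one, $\|w_t-w_*\|^2\to 0$ as $t\to\infty$.
   Context: $\xi$ is a random variable, $f(\cdot;\xi):\mathbb{R}^d\to\mathbb{R}$ is differentiable for every realization of $\xi$, $F(w)=\mathbb{E}[f(w;\xi)]$, and $\mathbb{E}[\nabla f(w;\xi)]=\nabla F(w)$ for every fixed $w\in\mathbb{R}^d$. The norm is Euclidean. $\mu$-strong convexity of $F$: $F(w)-F(w')\ge\langle\nabla F(w'),w-w'\rangle+\frac{\mu}{2}\|w-w'\|^2$ for all $w,w'\in\mathbb{R}^d$. $L$-smoothness of $f(\cdot;\xi)$ (with $L>0$ independent of the realization): $\|\nabla f(w;\xi)-\nabla f(w';\xi)\|\le L\|w-w'\|$ for all $w,w'$. Convexity of $f(\cdot;\xi)$: $f(w;\xi)-f(w';\xi)\ge\langle\nabla f(w';\xi),w-w'\rangle$ for all $w,w'$. In the SGD method, $w_0\in\mathbb{R}^d$ is a given initial point, the stepsizes $\eta_t$ are deterministic, and $\xi_0,\xi_1,\dots$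 are i.i.d. copies of $\xi$. The quantity $N=2\mathbb{E}[\|\nabla f(w_*;\xi)\|^2]$ is assumed finite. *)

(* Defs.v *)
From HB Require Import structures.
From mathcomp Require Export all_boot all_order all_algebra.
From mathcomp Require Export all_classical all_reals all_analysis.
Export Order.TTheory GRing.Theory Num.Theory.
Export numFieldNormedType.Exports.

Set Implicit Arguments.
Unset Strict Implicit.
Unset Printing Implicit Defensive.

Local Open Scope classical_set_scope.
Local Open Scope ring_scope.

Section euclidean.
Context {R : realType} {d : nat}.
Implicit Types (u v w : 'rV[R]_d) (f : 'rV[R]_d -> R).

Definition dotr u v : R := \sum_j u 0 j * v 0 j.

(* The library norm [`|u|] on ['rV[R]_d] is the sup norm, so the Euclidean
   norm is defined here. Both induce the same topology, hence the same notion
   of differentiability. *)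
Definition enorm u : R := Num.sqrt (dotr u u).

(* This is the gradient only at points where [f] is differentiable. *)
Definition grad f w : 'rV[R]_d := \row_j 'D_(delta_mx 0 j) f w.

Definition strongly_convex (mu : R) f :=
  forall w w', f w - f w' >= dotr (grad f w') (w - w')
                             + mu / 2 * enorm (w - w') ^+ 2.

Definition convex f :=
  forall w w', f w - f w' >= dotr (grad f w') (w - w').

Definition smooth (L : R) f :=
  forall w w', enorm (grad f w - grad f w') <= L * enorm (w - w').

Definition minimizer f w := forall w', f w <= f w'.

End euclidean.

Section probability.
Context {dO : measure_display} {Omega : measurableType dO} {R : realType}.
Variable P : probability Omega R.

(* The expectation of [X] exists, is finite, and equals [m]. *)
Definition has_mean (X : Omega -> R) (m : R) :=
  P.-integrable setT (EFin \o X) /\ 'E_P[X]%E = m%:E.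

Definition has_vmean {d : nat} (X : Omega -> 'rV[R]_d) (m : 'rV[R]_d) :=
  forall j, has_mean (fun o => X o 0 j) (m 0 j).

Context {dZ : measure_display} {Z : measurableType dZ}.

Definition mutually_independent {I : choiceType} (X : I -> {RV P >-> Z}) :=
  forall (J : seq I) (A : I -> set Z), uniq J ->
    (forall i, measurable (A i)) ->
    P (\bigcap_(i in [set` J]) (X i @^-1` A i)) =
    (\prod_(i <- J) P (X i @^-1` A i))%E.

End probability.

(* Distributions are compared on measurable sets only, since the value of a
   measure elsewhere is unspecified. *)
Definition iid_copies {R : realType}
    {dO : measure_display} {Omega : measurableType dO}
    {dO' : measure_display} {Omega' : measurableType dO'}
    {dZ : measure_display} {Z : measurableType dZ}
    (P : probability Omega R) (xi : {RV P >-> Z})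
    (P' : probability Omega' R) (xis : nat -> {RV P' >-> Z}) :=
  mutually_independent xis /\
  forall t (A : set Z), measurable A ->
    distribution P' (xis t) A = distribution P xi A.

Fixpoint sgd {R : realType} {d : nat} {Omega Z : Type}
    (f : 'rV[R]_d -> Z -> R) (eta : nat -> R) (xis : nat -> Omega -> Z)
    (w0 : 'rV[R]_d) (t : nat) (o : Omega) : 'rV[R]_d :=
  if t is s.+1 then
    let w := sgd f eta xis w0 s o in
    w - eta s *: grad (f^~ (xis s o)) w
  else w0.

(* Main.v *)
From mathcomp Require Import ring lra measurable_realfun.
Require Import Defs.

(** Let [v] be the minimizer, [D_t = |w_t - v|^2] and [N = 2 E|grad f(v)|^2].
    Cocoercivity of the gradients gives
    [E(D_(t+1) | F_t) <= (1 - mu eta_t) D_t + N eta_t^2],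
    so [Y_t = D_t + N sum_(k >= t) eta_k^2] is a nonnegative supermartingale.
    Taking expectations, [sum eta_t = +oo] forces [E Y_t] to take arbitrarily
    small values, and the maximal inequality
    [e * P(exists s >= t, Y_s >= e) <= E Y_t] then makes
    [limsup_s {Y_s >= e}] a null event for every [e > 0]. The conditional
    inequality is expressed as an inequality of integrals over the events
    of [F_t]. *)

Set Implicit Arguments.
Unset Strict Implicit.
Unset Printing Implicit Defensive.

Local Open Scope classical_set_scope.
Local Open Scope ring_scope.

(** * Smooth convex functions *)

(** The noise is controlled at [wstar] only, while gradients are sampled at the moving iterates.
    Cocoercivity transfers the control: the mean of |grad f(w)|^2 is at most 4 L (F(w) - F(v)) + N,
    and the excess over N is absorbed by the decrease that strong convexity provides; this is what
    the bound 1 / (2 L) on the step sizes is for. The one-step recursion is used twice. With the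
    contraction discarded it makes Y_t a supermartingale; with the contraction kept, in expectation,
    it yields a time at which E Y_t is small. The maximal inequality turns that single time into a
    bound on all later ones. The measure-theoretic obstacle is that the assumptions speak of f(w; .)
    for fixed w, whereas the iteration evaluates the gradient at a random w_t. Rounding w_t to
    rational vectors inside the sigma-algebra of the past reduces both measurability and the mean
    inequality to fixed vectors; smoothness gives the continuity in w needed to pass to the
    limit. *)

Section dotr_theory.
Context {R : realType} {d : nat}.
Implicit Types u v w : 'rV[R]_d.

Lemma dotrC u v : dotr u v = dotr v u.
Proof. by apply: eq_bigr => j _; rewrite mulrC. Qed.

Lemma dotrDl u v w : dotr (u + v) w = dotr u w + dotr v w.
Proof. by rewrite -big_split; apply: eq_bigr => j _; rewrite mxE mulrDl. Qed.

Lemma dotrZl a u v : dotr (a *: u) v = a * dotr u v.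
Proof. by rewrite mulr_sumr; apply: eq_bigr => j _; rewrite mxE mulrA. Qed.

Lemma dotrNl u v : dotr (- u) v = - dotr u v.
Proof. by rewrite -scaleN1r dotrZl mulN1r. Qed.

Lemma dotrDr u v w : dotr u (v + w) = dotr u v + dotr u w.
Proof. by rewrite !(dotrC u) dotrDl. Qed.

Lemma dotrZr a u v : dotr u (a *: v) = a * dotr u v.
Proof. by rewrite !(dotrC u) dotrZl. Qed.

Lemma dotrNr u v : dotr u (- v) = - dotr u v.
Proof. by rewrite !(dotrC u) dotrNl. Qed.

Definition dotrE := (dotrDl, dotrDr, dotrNl, dotrNr, dotrZl, dotrZr).

Lemma dotr_ge0 u : 0 <= dotr u u.
Proof. by apply: sumr_ge0 => j _; rewrite -expr2 sqr_ge0. Qed.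

Lemma sqr_enorm u : enorm u ^+ 2 = dotr u u.
Proof. by rewrite sqr_sqrtr// dotr_ge0. Qed.

Lemma le_coord_enorm u j : `|u 0 j| <= enorm u.
Proof.
rewrite -sqrtr_sqr ler_wsqrtr// /dotr (bigD1 j)//= expr2 lerDl.
by apply: sumr_ge0 => i _; rewrite -expr2 sqr_ge0.
Qed.

Lemma smooth_sqr (f : 'rV[R]_d -> R) (L : R) w w' : 0 <= L -> smooth L f ->
  dotr (grad f w - grad f w') (grad f w - grad f w') <=
  L ^+ 2 * dotr (w - w') (w - w').
Proof.
move=> L0 sf; rewrite -!sqr_enorm -exprMn ler_sqr ?nnegrE ?sqrtr_ge0//.
by rewrite mulr_ge0// sqrtr_ge0.
Qed.

End dotr_theory.

Section smooth_convex.
Context {R : realType} {d : nat}.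
Variables (f : 'rV[R]_d -> R) (L : R).
Hypotheses (L0 : 0 < L) (sf : smooth L f) (cf : convex f).
Implicit Types u v w x : 'rV[R]_d.

(** With [a] the gradient difference, smoothness gives |a| <= L c |v|. Expanding |a - L c v|^2 >= 0
    then gives 2 L c <a, v> <= 2 (L c)^2 |v|^2, and L c > 0 is divided out. *)
Lemma smooth_dotr_grad x v (c : R) : 0 < c ->
  dotr (grad f (x + c *: v) - grad f x) v <= L * c * dotr v v.
Proof.
move=> c0.
have Lc : 0 < L * c by rewrite mulr_gt0.
have := smooth_sqr (x + c *: v) x (ltW L0) sf.
rewrite {3 4}(addrC x) addrK; move: (_ - _) => a.
have := dotr_ge0 (a - (L * c) *: v).
rewrite !dotrE (dotrC v a) => sq asq.
rewrite -(ler_pM2l Lc); nra.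
Qed.

(* Summing the convexity inequality over [n] equal substeps gives the constant
   [L * (n + 1) / (2 * n)], which tends to [L / 2]. *)
Lemma descent_substeps x v (n i : nat) :
  f (x + (i%:R / n.+1%:R) *: v) - f x <= i%:R / n.+1%:R * dotr (grad f x) v
    + L * dotr v v * (i%:R * i.+1%:R / 2 / n.+1%:R ^+ 2).
Proof.
elim: i => [|i IH]; first by rewrite !mul0r scale0r addr0 subrr mulr0 addr0.
set N : R := n.+1%:R in IH *; have N0 : 0 < N by rewrite ltr0n.
have iN0 : 0 < i.+1%:R / N :> R by rewrite divr_gt0.
(* Convexity at the right end of the substep bounds the increase of [f] from above. Each increase
   contributes L |v|^2 (i + 1) / N^2, and the factors i + 1 add up to the triangular number in the
   statement. *)
have := cf (x + (i%:R / N) *: v) (x + (i.+1%:R / N) *: v).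
have -> : x + (i%:R / N) *: v - (x + (i.+1%:R / N) *: v) = (- N^-1) *: v.
  rewrite opprD addrACA subrr add0r -scalerBl; congr (_ *: _).
  by rewrite -(@natr1 _ i); field; rewrite gt_eqF.
have := smooth_dotr_grad x v iN0; rewrite !dotrE => h1 h2.
have N10 : 0 < N^-1 by rewrite invr_gt0.
move: h1 h2 IH; rewrite -!exprVn -(@natr1 _ i.+1) -(@natr1 _ i).
move: (i%:R : R) => I.
move: N10; move: (N^-1) (dotr (grad f x) v) (dotr v v) => M g V M0.
move: (dotr _ v) (f _) (f _) => g' f' f'' h1 h2 IH.
have h3 := ler_wpM2l (ltW M0) h1; lra.
Qed.

Lemma descent x v :
  f (x + v) - f x - dotr (grad f x) v <= L / 2 * dotr v v.
Proof.
suff bound (e : R) : 0 < e ->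
    f (x + v) - f x - dotr (grad f x) v <= L / 2 * dotr v v + e.
  by apply/ler_addgt0Pr.
move=> e0.
(* With all [N = n + 1] substeps the bound exceeds the limit L / 2 |v|^2 by exactly [K / N]. *)
pose K := L * dotr v v / 2.
have K0 : 0 <= K by rewrite divr_ge0// mulr_ge0 ?dotr_ge0// ltW.
pose n := Num.bound (K / e).
have nb : K / e < n.+1%:R.
  apply: (@lt_trans _ _ n%:R); last by rewrite ltr_nat.
  by rewrite archi_boundP// divr_ge0// ltW.
have N0 : 0 < n.+1%:R :> R by rewrite ltr0n.
have := descent_substeps x v n n.+1.
rewrite divff ?gt_eqF// scale1r mul1r -(@natr1 _ n.+1).
move: nb N0; set N : R := n.+1%:R => nb N0.
have -> : N * (N + 1) / 2 / N ^+ 2 = 1 / 2 + N^-1 / 2.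
  by field; rewrite gt_eqF.
have : K / N <= e by rewrite ler_pdivrMr// mulrC -ler_pdivrMr// ltW.
rewrite /K; move: (N^-1) (dotr v v) => M V h1 h2; lra.
Qed.

Lemma cocoercive w w' :
  dotr (grad f w - grad f w') (grad f w - grad f w') <=
  2 * L * (f w - f w' - dotr (grad f w') (w - w')).
Proof.
move aE : (grad f w - grad f w') => a.
(* Bound [f] at the test point [w - a / L] from above by descent at [w] and
   from below by convexity at [w']. *)
have h1 := descent w (- L^-1 *: a).
have h2 := cf (w + - L^-1 *: a) w'.
have h3 : dotr a a = dotr (grad f w) a - dotr (grad f w') a.
  by rewrite -{1}aE dotrDl dotrNl.
move: h1 h2; rewrite !dotrE.
have -> : L / 2 * (- L^-1 * (- L^-1 * dotr a a)) = L^-1 * dotr a a / 2.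
  by field; rewrite gt_eqF.
move: (dotr a a) (f (w + _)) h3 => A fu h3 h1 h2.
have {}h3 : L^-1 * dotr (grad f w) a - L^-1 * dotr (grad f w') a = L^-1 * A.
  by rewrite -mulrBr -h3.
have L'0 : 0 < L^-1 by rewrite invr_gt0.
rewrite -(ler_pM2l L'0) (mulrC 2) -!mulrA mulKf ?gt_eqF//; lra.
Qed.

Lemma sgd_step_le (eta : R) w w' :
  dotr (w - eta *: grad f w - w') (w - eta *: grad f w - w') <=
  dotr (w - w') (w - w') - 2 * eta * dotr (grad f w) (w - w')
  + eta ^+ 2 * (4 * L * (f w - f w' - dotr (grad f w') (w - w'))
                + 2 * dotr (grad f w') (grad f w')).
Proof.
have := cocoercive w w'.
(* This square equals 2|g - g'|^2 + 2|g'|^2 - |g|^2, with [g], [g'] the gradients at [w], [w'];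
   together with cocoercivity it produces the constants 4 L and 2. *)
have := dotr_ge0 (grad f w - 2 *: grad f w').
set B := f w - _ - _.
have -> : w - eta *: grad f w - w' = (w - w') - eta *: grad f w.
  by rewrite addrAC.
move: (w - w') => D; move: (grad f w) (grad f w') => g g'.
rewrite !dotrE (dotrC g' g) (dotrC g D) => h1 h2.
have : dotr g g <= 4 * L * B + 2 * dotr g' g' by lra.
move=> /(ler_wpM2l (sqr_ge0 eta)); lra.
Qed.

End smooth_convex.

Section minimum.
Context {R : realType} {d : nat}.

Lemma minimizer_grad0 (F : 'rV[R]_d -> R) w :
  differentiable F w -> minimizer F w -> grad F w = 0.
Proof.
move=> dF mF; apply/rowP => j; rewrite !mxE.
set v := delta_mx 0 j.
have dv : derivable F w v by exact: diff_derivable.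
apply/eqP; rewrite eq_le; apply/andP; split.
- rewrite /derive cvg_at_leftE//; apply: limr_le.
    apply: cvgP; apply: cvg_dnbhs_at_left; exact: dv.
  near=> h; have h0 : h < 0 by near: h; exact: nbhs_left_lt.
  by apply: mulr_le0_ge0; rewrite ?invr_le0 ?(ltW h0)// subr_ge0 mF.
- rewrite /derive cvg_at_rightE//; apply: limr_ge.
    apply: cvgP; apply: cvg_dnbhs_at_right; exact: dv.
  near=> h; have h0 : 0 < h by near: h; exact: nbhs_right_gt.
  by apply: mulr_ge0; rewrite ?invr_ge0 ?(ltW h0)// subr_ge0 mF.
Unshelve. all: by end_near. Qed.

End minimum.

(** * Functions of an independent variable *)

Section ratvec.
Context {R : realType} {d : nat}.

(** Only density matters, so the value 0 at codes that decode to nothing is harmless. *)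
Definition ratvec (i : nat) : 'rV[R]_d :=
  if unpickle i is Some q then map_mx ratr (q : 'rV[rat]_d) else 0.

Lemma ratvec_dense (w : 'rV[R]_d) (A : set 'rV[R]_d) :
  nbhs w A -> exists i, A (ratvec i).
Proof.
move=> /nbhs_ballP[e /= e0 eA].
have /choice[q qw] j : exists r : rat, ball (w 0 j) e (ratr r : R).
  have /rat_in_itvoo[r] : w 0 j < w 0 j + e by rewrite ltrDl.
  rewrite in_itv/= => /andP[wr re]; exists r.
  rewrite /ball/= ltr_distlC; apply/andP; split=> //.
  by apply: lt_trans wr; rewrite ltrBlDr ltrDl.
exists (pickle (\row_j q j)); apply: eA.
by rewrite /ratvec pickleK; split=> // i j; rewrite !mxE ord1; exact: qw.
Qed.

End ratvec.

Section measurable_lt.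
Context {R : realType} {dT : measure_display} {T : measurableType dT}.

Lemma measurable_set_lt (f g : T -> R) :
  measurable_fun setT f -> measurable_fun setT g ->
  measurable [set x | f x < g x].
Proof.
move=> mf mg; rewrite -[X in measurable X]setTI.
by have := measurable_fun_ltr mf mg; apply.
Qed.

End measurable_lt.

Section discretization.
Context {R : realType} {d : nat} {dT : measure_display} {T : measurableType dT}.
Variables (W : T -> 'rV[R]_d) (phi : 'rV[R]_d -> R).
Hypothesis mW : forall j, measurable_fun setT (fun x => W x 0 j).
Hypothesis cphi : continuous phi.
Hypothesis mphi : measurable_fun setT (phi \o W).

(* Rounding [W] to a nearby rational vector makes it countably valued; the
   rounding is chosen so that [phi] increases by at most [1 / (k + 1)], which
   spares a domination hypothesis when passing to the limit in integrals. *)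
Lemma discretization : exists N : nat -> T -> nat,
  [/\ forall k i, measurable [set x | N k x = i],
      forall x, ratvec (N k x) @[k --> \oo] --> W x &
      forall k x, phi (ratvec (N k x)) <= phi (W x) + k.+1%:R^-1].
Proof.
pose Q k i := [set x | (forall j, `|W x 0 j - ratvec i 0 j| < k.+1%:R^-1) /\
  phi (ratvec i) < phi (W x) + k.+1%:R^-1].
have mQ k i : measurable (Q k i).
  have -> : Q k i =
      \bigcap_(j in [set: 'I_d])
        [set x | `|W x 0 j - ratvec i 0 j| < k.+1%:R^-1]
      `&` [set x | phi (ratvec i) < phi (W x) + k.+1%:R^-1].
    apply/seteqP; split=> x [h1 h2]; split=> // j; last exact: h1.
    by move=> _; exact: h1.
  apply: measurableI.
    apply: fin_bigcap_measurable => // j _; apply: measurable_set_lt => //.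
    by apply: measurableT_comp => //; exact: measurable_funB.
  by apply: measurable_set_lt => //; exact: measurable_funD.
have covQ k x : exists i, Q k i x.
  pose e : R := k.+1%:R^-1.
  have e0 : 0 < e by rewrite invr_gt0.
  have [//|i [Bi phii]] := @ratvec_dense R d (W x)
      (ball (W x) e `&` [set w | phi w < phi (W x) + e]).
    apply: filterI; first exact: nbhsx_ballx.
    have lte : phi (W x) < phi (W x) + e by rewrite ltrDl.
    exact: (cphi (lt_nbhsl lte)).
  by exists i; split=> // j; have [_] := Bi; exact.
(* Making the sets disjoint selects the first admissible index, so the level sets of [N k] are the
   measurable sets [E k i]. The default of [xget] is never taken, because the [Q k i] cover the
   space. *)
pose E k i := seqDU (Q k) i.
have mE k i : measurable (E k i) by exact: seqDU_measurable.
pose N k x := xget 0%N [set i | E k i x].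
have EN k x : E k (N k x) x.
  have [i Qi] := covQ k x.
  have : (\bigcup_i Q k i) x by exists i.
  rewrite seqDU_bigcup_eq => -[j _ Ej].
  by apply: (@xgetPex _ 0%N [set i | E k i x]); exists j.
have NE k i : [set x | N k x = i] = E k i.
  apply/seteqP; split=> [x <-//|x Ei].
  apply: (trivIset_seqDU (Q k)) => //.
  by exists x; split=> //; exact: EN.
have QN k x : Q k (N k x) x by have [] := EN k x.
exists N; split=> [k i|x|k x].
- by rewrite NE.
- apply/cvg_ballP => e e0.
  have := near_infty_natSinv_lt (PosNum e0); apply: filterS => k ke.
  split=> // i j.
  have [/(_ j) Qj _] := QN k x; rewrite ord1.
  exact: lt_trans Qj ke.
- by have [_ /ltW] := QN k x.
Qed.

End discretization.

Section caratheodory.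
Context {R : realType} {d : nat} {dT dZ : measure_display}
  {T : measurableType dT} {Z : measurableType dZ}.
Variables (h : 'rV[R]_d -> Z -> R).
Hypothesis mh : forall w, measurable_fun setT (h w).
Hypothesis ch : forall z, continuous (h^~ z).

Lemma measurable_fun_countable_index (N : T -> nat) (q : nat -> 'rV[R]_d)
    (xi : T -> Z) :
  (forall i, measurable [set x | N x = i]) -> measurable_fun setT xi ->
  measurable_fun setT (fun x => h (q (N x)) (xi x)).
Proof.
move=> mN mxi _ B mB; rewrite setTI.
have -> : (fun x => h (q (N x)) (xi x)) @^-1` B =
    \bigcup_i ([set x | N x = i] `&` (h (q i) \o xi) @^-1` B).
  by apply/seteqP; split=> [x Bx|x [i _ [/= <-]]//]; exists (N x).
apply: bigcup_measurable => i _; apply: measurableI; first exact: mN.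
by rewrite -[X in measurable X]setTI; apply: measurableT_comp.
Qed.

(** By continuity in the vector this is a pointwise limit of the functions with [W] rounded, which
    are glued from countably many measurable pieces. It makes the gradient at a random iterate
    measurable. *)
Lemma measurable_caratheodory (W : T -> 'rV[R]_d) (xi : T -> Z) :
  (forall j, measurable_fun setT (fun x => W x 0 j)) ->
  measurable_fun setT xi ->
  measurable_fun setT (fun x => h (W x) (xi x)).
Proof.
move=> mW mxi.
have c0 : continuous (cst 0 : 'rV[R]_d -> R) by exact: cst_continuous.
have [N [mN NW _]] := discretization mW c0 (measurable_cst (0 : R)).
apply: (@measurable_fun_cvg _ _ _ _ (fun k x => h (ratvec (N k x)) (xi x))).
  by move=> k; exact: measurable_fun_countable_index.
move=> x _; apply: (@cvg_comp _ _ _ (fun k => ratvec (N k x)) (h^~ (xi x))).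
  exact: NW.
exact: ch.
Qed.

End caratheodory.

Section independence.
Local Open Scope ereal_scope.
Context {R : realType} {d : nat} {dT dZ : measure_display}
  {T : measurableType dT} {Z : measurableType dZ}.
Variables (P : probability T R) (nu : {measure set Z -> \bar R}).
Variables (G : set (set T)) (xi : T -> Z).
Hypotheses (Gm : G `<=` measurable) (mxi : measurable_fun setT xi).
Hypothesis indep : forall B C, <<s G >> B -> measurable C ->
  P (B `&` xi @^-1` C) = P B * nu C.

Lemma sub_sigma_measurable : <<s G >> `<=` measurable.
Proof. exact: (smallest_sub (@sigma_algebra_measurable _ T) Gm). Qed.

(** Independence says that [xi] carries [P] restricted to [B] to the measure [P B * nu]; integrating
    [g] against both descriptions gives the two sides. *)
Lemma integral_indep (B : set T) (g : Z -> \bar R) : <<s G >> B ->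
  measurable_fun setT g -> (forall z, 0 <= g z) ->
  \int[P]_(x in B) g (xi x) = P B * \int[nu]_z g z.
Proof.
move=> GB mg g0.
have mB : measurable B by exact: sub_sigma_measurable.
have PBfin : P B \is a fin_num by rewrite fin_num_measure.
have PB0 : (0 <= fine (P B))%R by rewrite fine_ge0.
transitivity (\int[mrestr P mB]_x g (xi x)).
  have fm D : measurable_fun D (g \o xi).
    by apply: measurable_funTS; exact: measurableT_comp.
  rewrite -(setUv B) ge0_integral_setU//; last first.
  - exact/disj_setPCl.
  - exact: measurableC.
  rewrite (@eq_measure_integral _ _ _ (~` B) mzero)//; last first.
    move=> C mC /disjoints_subset CB.
    by rewrite /= /mrestr CB measure0.
  rewrite integral_measure_zero adde0; apply: eq_measure_integral => C mC CB.
  by rewrite /= /mrestr setIidl.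
transitivity (\int[pushforward (mrestr P mB) xi]_z g z).
  by rewrite ge0_integral_pushforward// => z _.
rewrite -[P B]fineK//.
transitivity (\int[mscale (NngNum PB0) nu]_z g z).
  apply: eq_measure_integral => C mC _.
  rewrite /= /mscale/= /pushforward /mrestr fineK// setIC; exact: indep.
by rewrite ge0_integral_mscale.
Qed.

Variables (W : T -> 'rV[R]_d) (h : 'rV[R]_d -> Z -> R) (phi : 'rV[R]_d -> R).
Hypothesis mW : forall j,
  @measurable_fun _ _ (g_sigma_algebraType G) _ setT (fun x => W x 0%R j).
Hypothesis mh : forall w, measurable_fun setT (h w).
Hypothesis ch : forall z, continuous (h^~ z).
Hypothesis h0 : forall w z, (0 <= h w z)%R.
Hypothesis cphi : continuous phi.
Hypothesis hphi : forall w, \int[nu]_z (h w z)%:E <= (phi w)%:E.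

(* Replaces the conditional expectation given the sigma-algebra of [W]: sum
   over the countably many values of the rounded [W], then apply Fatou. *)
Lemma integral_indep_le (A : set T) : <<s G >> A ->
  \int[P]_(x in A) (h (W x) (xi x))%:E <= \int[P]_(x in A) (phi (W x))%:E.
Proof.
move=> GA.
have mA : measurable A by exact: sub_sigma_measurable.
have phi0 w : (0 <= phi w)%R.
  rewrite -lee_fin (le_trans _ (hphi w))//.
  by apply: integral_ge0 => z _; rewrite lee_fin.
have mphi : @measurable_fun _ _ (g_sigma_algebraType G) _ setT (phi \o W).
  apply: (@measurable_caratheodory R d _ _ (g_sigma_algebraType G)
    (g_sigma_algebraType G) (fun w _ => phi w) _ _ W id) => //.
have mphiP : measurable_fun setT (phi \o W).
  move=> _ B mB; apply: sub_sigma_measurable; exact: mphi.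
(* The rounding is done in the sigma-algebra generated by [G], not merely in that of [T], because
   its level sets must be independent of [xi]. *)
have [N [mN NW Nphi]] : exists N : nat -> T -> nat,
    [/\ forall k i, <<s G >> [set x | N k x = i],
        forall x, ratvec (N k x) @[k --> \oo] --> W x &
        forall k x, (phi (ratvec (N k x)) <= phi (W x) + k.+1%:R^-1)%R].
  exact: (@discretization R d _ (g_sigma_algebraType G) W phi mW cphi mphi).
have mhN k : measurable_fun setT (fun x : T => h (ratvec (N k x)) (xi x)).
  apply: measurable_fun_countable_index => // i.
  exact: (sub_sigma_measurable (mN k i)).
have step k : \int[P]_(x in A) (h (ratvec (N k x)) (xi x))%:E <=
    \int[P]_(x in A) (phi (W x))%:E + (k.+1%:R^-1)%:E.
  pose D i := A `&` [set x | N k x = i].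
  have DG i : <<s G >> (D i).
    exact: (@measurableI _ (g_sigma_algebraType G) _ _ GA (mN k i)).
  have mD i : measurable (D i) by exact: sub_sigma_measurable.
  have DA : A = \bigcup_i D i.
    rewrite -setI_bigcupr -[LHS]setIT; congr (_ `&` _).
    by apply/seteqP; split=> // x _; exists (N k x).
  have mphie : measurable_fun setT
      (fun x : T => (phi (W x))%:E + (k.+1%:R^-1)%:E).
    by apply/measurable_EFinP; apply: measurable_funD.
  have tD : trivIset setT D.
    by move=> i j _ _ [x [[_ Ni] [_ Nj]]]; rewrite -[i]Ni -[j]Nj.
  have e0 : 0 <= (k.+1%:R^-1 : R)%:E by rewrite lee_fin invr_ge0.
  apply: (@le_trans _ _ (\int[P]_(x in A) ((phi (W x))%:E + (k.+1%:R^-1)%:E))).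
    rewrite DA !ge0_integral_bigcup//.
    - apply: lee_nneseries => [i _ _|i _].
        by apply: integral_ge0 => x _; rewrite lee_fin.
      apply: (@le_trans _ _ (\int[P]_(x in D i) (phi (ratvec i))%:E)).
        have -> : \int[P]_(x in D i) (h (ratvec (N k x)) (xi x))%:E =
            \int[P]_(x in D i) (h (ratvec i) (xi x))%:E.
          by apply: eq_integral => x /[!inE] -[_ /= ->].
        rewrite (integral_indep (g := fun z => (h (ratvec i) z)%:E))//.
        - by rewrite integral_cst// muleC lee_wpmul2r.
        - exact/measurable_EFinP.
        - by move=> z; rewrite lee_fin.
      apply: ge0_le_integral => //.
      - by move=> x _; rewrite lee_fin.
      - exact: measurable_funTS.
      - by move=> x [_ /= Nx]; rewrite -EFinD lee_fin -[in leLHS]Nx.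
    - rewrite -DA; exact: measurable_funTS.
    - by move=> x _; rewrite -EFinD lee_fin addr_ge0// invr_ge0.
    - by rewrite -DA; apply/measurable_EFinP; exact: measurable_funTS.
    - by move=> x _; rewrite lee_fin.
  rewrite ge0_integralD//.
  - rewrite leeD2l// integral_cst// -[leRHS]mule1 lee_wpmul2l//.
    exact: probability_le1.
  - by move=> x _; rewrite lee_fin.
  - by apply/measurable_EFinP; exact: measurable_funTS.
have -> : \int[P]_(x in A) (h (W x) (xi x))%:E =
    \int[P]_(x in A) limn_einf (fun k => (h (ratvec (N k x)) (xi x))%:E).
  apply: eq_integral => x _; apply/esym.
  apply: (cvg_limn_einf_sup _).1.
  apply: cvg_EFin; first exact: nearW.
  apply: (@cvg_comp _ _ _ (fun k => ratvec (N k x)) (h^~ (xi x))).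
    exact: NW.
  exact: ch.
apply: le_trans.
  apply: fatou => // k.
    by apply/measurable_EFinP; exact: measurable_funTS.
  by move=> x _; rewrite lee_fin.
rewrite limn_einf_lim; apply: lime_le; first exact: is_cvg_einfs.
apply: nearW => n.
apply/lee_addgt0Pr => e e0.
(* The infimum over the indices from [n] on is at most the term of index [n + m], where the rounding
   error is already below [e]. *)
have [m _ me] := near_infty_natSinv_lt (PosNum e0).
apply: (@le_trans _ _
  (\int[P]_(x in A) (h (ratvec (N (n + m)%N x)) (xi x))%:E)).
  by apply: ereal_inf_lbound; exists (n + m)%N => //=; rewrite leq_addr.
apply: (le_trans (step _)); rewrite leeD2l// lee_fin ltW// me//=.
by rewrite leq_addl.
Qed.

End independence.

(** * One step of the iteration *)

Section regularity.
Context {R : realType} {d : nat}.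

Lemma measurable_dotr {dT : measure_display} {T : measurableType dT}
    (u v : T -> 'rV[R]_d) :
  (forall j, measurable_fun setT (fun x => u x 0 j)) ->
  (forall j, measurable_fun setT (fun x => v x 0 j)) ->
  measurable_fun setT (fun x => dotr (u x) (v x)).
Proof. by move=> mu mv; apply: measurable_sum => j; exact: measurable_funM. Qed.

Lemma continuous_dotr {T : topologicalType} (u v : T -> 'rV[R]_d) :
  (forall j, continuous (fun x => u x 0 j)) ->
  (forall j, continuous (fun x => v x 0 j)) ->
  continuous (fun x => dotr (u x) (v x)).
Proof.
move=> cu cv; apply: continuous_big => [|j _ x]; first exact: add_continuous.
by apply: cvgM; [exact: cu|exact: cv].
Qed.

Lemma continuous_mull {T : topologicalType} (a : R) (g : T -> R) :
  continuous g -> continuous (fun x => a * g x).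
Proof.
by move=> cg x; apply: continuousM; [exact: cst_continuous|exact: cg].
Qed.

Lemma continuous_add {T : topologicalType} (g h : T -> R) :
  continuous g -> continuous h -> continuous (fun x => g x + h x).
Proof. by move=> cg ch x; apply: continuousD; [exact: cg|exact: ch]. Qed.

(** Smoothness uses the Euclidean norm while neighbourhoods come from the sup norm. The bridge is
    L^2 |w - w'|^2, a polynomial in the coordinates of w', hence continuous, which vanishes at w' =
    w and dominates the squared gradient difference. *)
Lemma continuous_grad (f : 'rV[R]_d -> R) (L : R) j :
  0 < L -> smooth L f -> continuous (fun w => grad f w 0 j).
Proof.
move=> L0 sf w; apply/(@cvgrPdist_lt _ _ _ (nbhs w) (nbhs_filter w)) => e e0.
have c : continuous (fun w' : 'rV[R]_d => L ^+ 2 * dotr (w - w') (w - w')).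
  have cw i : continuous (fun w' : 'rV[R]_d => (w - w') 0 i).
    move=> w'; under eq_fun do rewrite !mxE.
    by apply: continuousB; [exact: cst_continuous|exact: coord_continuous].
  by apply: continuous_mull; exact: continuous_dotr.
have lte : L ^+ 2 * dotr (w - w) (w - w) < e ^+ 2.
  rewrite subrr /dotr big1 ?mulr0 ?exprn_gt0// => i _.
  by rewrite mxE mul0r.
have := c w _ (lt_nbhsl lte).
apply: (@filterS _ _ (nbhs_filter w)) => w' /= we.
rewrite -ltr_sqr ?nnegrE ?normr_ge0 ?(ltW e0)//.
apply: le_lt_trans we; apply: le_trans (smooth_sqr _ _ (ltW L0) sf).
rewrite -sqr_enorm ler_sqr ?nnegrE ?normr_ge0 ?sqrtr_ge0//.
by have := le_coord_enorm (grad f w - grad f w') j; rewrite !mxE.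
Qed.

(** A limit of difference quotients along the steps 1 / (n + 1), each measurable in [z]. *)
Lemma measurable_grad {dZ : measure_display} {Z : measurableType dZ}
    (f : 'rV[R]_d -> Z -> R) w j :
  (forall w, measurable_fun setT (f w)) ->
  (forall z, differentiable (f^~ z) w) ->
  measurable_fun setT (fun z => grad (f^~ z) w 0 j).
Proof.
move=> mf df; pose v : 'rV[R]_d := delta_mx 0 j.
apply: (@measurable_fun_cvg _ _ _ _
  (fun n z => n.+1%:R * (f (n.+1%:R^-1 *: v + w) z - f w z))).
  move=> n; apply: measurable_funM => //; exact: measurable_funB.
move=> z _; rewrite mxE.
have /cvg_ex[/= l fl] : derivable (f^~ z) w v by exact: diff_derivable.
have -> : 'D_v (f^~ z) w = l by exact: cvg_lim fl.
have h0 : (n.+1%:R^-1 : R) @[n --> \oo] --> 0^'.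
  move=> A /nbhs_ballP[e e0 eA].
  have := near_infty_natSinv_lt (PosNum e0); apply: filterS => n ne.
  apply: eA; last by rewrite /= invr_neq0.
  by rewrite /ball/= sub0r normrN ger0_norm// invr_ge0.
have := cvg_comp _ _ h0 fl; apply: cvg_trans; apply: near_eq_cvg.
by apply: nearW => n; rewrite /= invrK.
Qed.

End regularity.

Section mean.
Context {dO : measure_display} {Omega : measurableType dO} {R : realType}.
Variable P : probability Omega R.
Implicit Types (X Y : Omega -> R) (m : R).

Lemma has_meanE X m : has_mean P X m <->
  P.-integrable setT (EFin \o X) /\ (\int[P]_o (X o)%:E = m%:E)%E.
Proof. by rewrite /has_mean expectation.unlock. Qed.

Lemma has_mean_cst m : has_mean P (cst m) m.
Proof.
apply/has_meanE; split; first by apply: finite_measure_integrable_cst.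
rewrite (integral_cst P measurableT m%:E).
rewrite [X in (_ * X)%E](_ : _ = 1%E) ?mule1//.
exact: probability_setT.
Qed.

Lemma has_meanD X Y m n : has_mean P X m -> has_mean P Y n ->
  has_mean P (fun o => X o + Y o) (m + n).
Proof.
move=> /has_meanE[iX EX] /has_meanE[iY EY]; apply/has_meanE; split.
  exact: (integrableD measurableT iX iY).
by rewrite EFinD -EX -EY; exact: (integralD measurableT iX iY).
Qed.

Lemma has_meanZ a X m : has_mean P X m -> has_mean P (fun o => a * X o) (a * m).
Proof.
move=> /has_meanE[iX EX]; apply/has_meanE; split.
  exact: (integrableZl measurableT a iX).
by rewrite EFinM -EX; exact: (integralZl measurableT iX a).
Qed.

Lemma has_mean_dotr d (X : Omega -> 'rV[R]_d) (m v : 'rV[R]_d) :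
  has_vmean P X m -> has_mean P (fun o => dotr (X o) v) (dotr m v).
Proof.
move=> Xm; rewrite /dotr.
elim: (index_enum _) => [|j s IH].
  under eq_fun do rewrite big_nil; rewrite big_nil; exact: has_mean_cst.
under eq_fun do rewrite big_cons mulrC; rewrite big_cons mulrC.
by apply: has_meanD IH; apply: has_meanZ; exact: Xm.
Qed.

Lemma has_mean_le X Y m : measurable_fun setT X ->
  (forall o, 0 <= X o <= Y o) -> has_mean P Y m ->
  (\int[P]_o (X o)%:E <= m%:E)%E.
Proof.
move=> mX XY /has_meanE[/measurable_int iY <-]; apply: ge0_le_integral => //.
- by move=> o _; rewrite lee_fin; case/andP: (XY o).
- exact/measurable_EFinP.
- by move=> o _; rewrite lee_fin; case/andP: (XY o).
Qed.

Lemma ge0_has_mean X : measurable_fun setT X -> (forall o, 0 <= X o) ->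
  ('E_P[X] < +oo)%E -> exists m, has_mean P X m.
Proof.
rewrite expectation.unlock => mX X0 Xoo; have E0 : (0 <= \int[P]_o (X o)%:E)%E.
  by apply: integral_ge0 => o _; rewrite lee_fin.
exists (fine (\int[P]_o (X o)%:E)%E); apply/has_meanE; split; last first.
  by rewrite fineK// ge0_fin_numE.
apply/integrableP; split; first exact/measurable_EFinP.
by under eq_integral do rewrite /= ger0_norm//.
Qed.

End mean.

Section sgd_step.
Context {R : realType} {d : nat}.

Definition sqdist_step {Z : Type} (f : 'rV[R]_d -> Z -> R) (eta : R)
    (wstar w : 'rV[R]_d) (z : Z) : R :=
  dotr (w - eta *: grad (f^~ z) w - wstar) (w - eta *: grad (f^~ z) w - wstar).

(** Here [s] will be the mean of |grad f(wstar)|^2, so [2 * s] is N. Being continuous in [w], this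
    bound can play the role of [phi] when the iterate is rounded. *)
Definition sqdist_bound (mu eta s : R) (wstar w : 'rV[R]_d) : R :=
  (1 - mu * eta) * dotr (w - wstar) (w - wstar) + eta ^+ 2 * (2 * s).

Lemma continuous_sqdist_bound mu eta s wstar :
  continuous (sqdist_bound mu eta s wstar).
Proof.
have cw j : continuous (fun w : 'rV[R]_d => (w - wstar) 0 j).
  move=> w; under eq_fun do rewrite !mxE.
  by apply: continuousB; [exact: coord_continuous|exact: cst_continuous].
apply: continuous_add; last exact: cst_continuous.
by apply: continuous_mull; exact: continuous_dotr.
Qed.

Lemma continuous_sqdist_step {Z : Type} (f : 'rV[R]_d -> Z -> R) L eta wstar z :
  0 < L -> smooth L (f^~ z) ->
  continuous (fun w => sqdist_step f eta wstar w z).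
Proof.
move=> L0 sf.
have cw j : continuous
    (fun w : 'rV[R]_d => (w - eta *: grad (f^~ z) w - wstar) 0 j).
  rewrite (_ : (fun _ => _) = fun w : 'rV[R]_d =>
      w 0 j + - eta * grad (f^~ z) w 0 j + - wstar 0 j); last first.
    by apply/funext => w; rewrite !mxE mulNr.
  apply: continuous_add; last exact: cst_continuous.
  apply: continuous_add; first exact: coord_continuous.
  by apply: continuous_mull; exact: continuous_grad sf.
exact: continuous_dotr.
Qed.

Context {dZ : measure_display} {Z : measurableType dZ}.
Context {dO : measure_display} {Omega : measurableType dO}.
Variables (P : probability Omega R) (xi : {RV P >-> Z}).
Variables (f : 'rV[R]_d -> Z -> R) (F : 'rV[R]_d -> R) (mu L s : R).
Variable wstar : 'rV[R]_d.
Hypothesis mf : forall w, measurable_fun setT (f w).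
Hypothesis df : forall z w, differentiable (f^~ z) w.

Lemma measurable_sqdist_step eta w :
  measurable_fun setT (sqdist_step f eta wstar w).
Proof.
have mg j : measurable_fun setT
    (fun z => (w - eta *: grad (f^~ z) w - wstar) 0 j).
  rewrite (_ : (fun _ => _) = fun z =>
      w 0 j + - eta * grad (f^~ z) w 0 j + - wstar 0 j); last first.
    by apply/funext => z; rewrite !mxE mulNr.
  apply: measurable_funD => //; apply: measurable_funD => //.
  by apply: measurable_funM => //; exact: measurable_grad.
exact: measurable_dotr.
Qed.

Hypothesis Ff : forall w, has_mean P (fun o => f w (xi o)) (F w).
Hypothesis dF : forall w, differentiable F w.
Hypothesis gF : forall w, has_vmean P (fun o => grad (f^~ (xi o)) w) (grad F w).
Hypothesis sc : strongly_convex mu F.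
Hypothesis L0 : 0 < L.
Hypothesis sf : forall z, smooth L (f^~ z).
Hypothesis cf : forall z, convex (f^~ z).
Hypothesis minF : minimizer F wstar.
Hypothesis gs : has_mean P
  (fun o => dotr (grad (f^~ (xi o)) wstar) (grad (f^~ (xi o)) wstar)) s.

(** Averages [sgd_step_le] at [w' = wstar]. As grad F vanishes at [wstar], the term multiplied by 4
    L has mean F(w) - F(wstar). Strong convexity bounds <grad F(w), w - wstar> below by F(w) -
    F(wstar) + mu / 2 |w - wstar|^2, whence the factor 1 - mu eta. *)
Lemma sgd_step_mean (eta : R) w : 0 < eta <= 1 / (2 * L) ->
  (\int[distribution P xi]_z (sqdist_step f eta wstar w z)%:E <=
   (sqdist_bound mu eta s wstar w)%:E)%E.
Proof.
move=> /andP[eta0 etaL].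
rewrite (@ge0_integral_distribution _ _ _ _ _ P xi
  (fun z => (sqdist_step f eta wstar w z)%:E)); last 2 first.
- exact/measurable_EFinP/measurable_sqdist_step.
- by move=> z; rewrite lee_fin dotr_ge0.
move eD : (w - wstar) => D; pose D2 := dotr D D.
(* [U] rebuilds the right side of [sgd_step_le] term by term, giving its integrability and its mean
   together. *)
have U := has_meanD (has_meanD (has_mean_cst P D2)
   (has_meanZ (- (2 * eta)) (has_mean_dotr D (gF w))))
   (has_meanZ (eta ^+ 2) (has_meanD (has_meanZ (4 * L)
     (has_meanD (has_meanD (Ff w) (has_meanZ (-1) (Ff wstar)))
        (has_meanZ (-1) (has_mean_dotr D (gF wstar))))) (has_meanZ 2 gs))).
apply: le_trans.
  apply: (has_mean_le _ _ U).
    apply: measurableT_comp => //; exact: measurable_sqdist_step.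
  move=> o; rewrite dotr_ge0/=.
  have := sgd_step_le L0 (sf (xi o)) (cf (xi o)) eta w wstar.
  move/le_trans; apply; rewrite eD -/D2; lra.
rewrite lee_fin (minimizer_grad0 (dF wstar) minF).
have dot0 : dotr 0 D = 0 by rewrite -(scale0r D) dotrZl mul0r.
rewrite dot0 /sqdist_bound eD -/D2.
have := sc wstar w.
rewrite -opprB eD sqr_enorm !dotrE -/D2 => scw.
have Fmin : 0 <= F w - F wstar by rewrite subr_ge0; exact: minF.
have : 2 * L * eta <= 1 by move: etaL; rewrite ler_pdivlMr ?mulr_gt0// mulrC.
move=> eL.
(* Twice this inequality lets the 2 eta (F(w) - F(wstar)) gained from strong convexity absorb 4 L
   eta^2 (F(w) - F(wstar)). *)
have h1 : 2 * L * eta * (eta * (F w - F wstar)) <= eta * (F w - F wstar).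
  by rewrite ler_piMl// mulr_ge0// ltW.
have h2 := ler_wpM2l (ltW eta0) scw.
lra.
Qed.

End sgd_step.

(** * Events determined by the past *)

Section history.
Context {dT dZ : measure_display}
  {T : measurableType dT} {Z : measurableType dZ}.
Variable X : nat -> T -> Z.

(* A pi-system generating the sigma-algebra of [X 0], ..., [X s.-1]. *)
Definition history (s : nat) : set (set T) :=
  [set B | exists2 A : nat -> set Z, (forall i, measurable (A i)) &
           B = \bigcap_(i in `I_s) (X i @^-1` A i)].

Definition adapted {d} {Y : measurableType d} (s : nat) (W : T -> Y) :=
  @measurable_fun _ _ (g_sigma_algebraType (history s)) _ setT W.

Lemma setI_closed_history s : setI_closed (history s).
Proof.
move=> _ _ [A mA ->] [B mB ->]; exists (fun i => A i `&` B i).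
  by move=> i; exact: measurableI.
by rewrite -bigcapI.
Qed.

Lemma history_setT s : history s setT.
Proof.
by exists (fun=> setT) => //; apply/seteqP; split=> // x _ i _.
Qed.

Lemma history_succ s : <<s history s >> `<=` <<s history s.+1 >>.
Proof.
apply: sub_sigma_algebra2 => _ [A mA ->].
exists (fun i => if (i < s)%N then A i else setT); first by move=> i; case: ifP.
apply/seteqP; split=> x Ax i /= is1.
  by case: ifPn => // iS; exact: Ax.
by have := Ax i (leqW is1); rewrite /= is1.
Qed.

Lemma adapted_succ {d} {Y : measurableType d} s (W : T -> Y) :
  adapted s W -> adapted s.+1 W.
Proof. by move=> mW _ B mB; apply: history_succ; exact: mW. Qed.

Lemma adapted_history s : adapted s.+1 (X s).
Proof.
move=> _ B mB; rewrite setTI; apply: sub_sigma_algebra.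
exists (fun i => if i == s then B else setT); first by move=> i; case: ifP.
apply/seteqP; split=> x.
  by move=> Bx i _ /=; case: eqP => // ->.
by move=> /(_ s) /=; rewrite eqxx; exact.
Qed.

Hypothesis mX : forall i, measurable_fun setT (X i).

Lemma history_measurable s : history s `<=` measurable.
Proof.
move=> _ [A mA ->]; apply: bigcap_measurableType => i _.
by rewrite -[X in measurable X]setTI; exact: mX.
Qed.

End history.

(** For fixed [C] both sides are finite measures in [B]. Mutual independence makes them agree on the
    pi-system [history s], hence on the sigma-algebra it generates. *)
Lemma indep_history {R : realType} {dT dZ : measure_display}
    {T : measurableType dT} {Z : measurableType dZ} (P : probability T R)
    (X : nat -> {RV P >-> Z}) (s : nat) (B : set T) (C : set Z) :
  mutually_independent X -> <<s history (fun i => X i : T -> Z) s >> B ->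
  measurable C -> P (B `&` X s @^-1` C) = (P B * P (X s @^-1` C))%E.
Proof.
move=> indX GB mC.
have mXC : measurable (X s @^-1` C).
  by rewrite -[X in measurable X]setTI; exact: measurable_funP.
have PC0 : (0 <= fine (P (X s @^-1` C)))%R by rewrite fine_ge0.
have PCfin : P (X s @^-1` C) \is a fin_num by rewrite fin_num_measure.
suff : mrestr P mXC B = mscale (NngNum PC0) P B.
  by rewrite /= /mrestr /mscale/= fineK// muleC.
move: B GB.
apply: (@g_sigma_algebra_measure_unique _ _ _ _ _ (fun=> setT)).
- by apply: history_measurable => i.
- by move=> _; exact: history_setT.
- by rewrite bigcup_const.
- exact: setI_closed_history.
- move=> _ [A mA ->].
  rewrite /= /mrestr /mscale/= fineK// muleC.
  have capE n (A' : nat -> set Z) :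
      \bigcap_(i in [set` iota 0 n]) (X i @^-1` A' i) =
      \bigcap_(i in `I_n) (X i @^-1` A' i).
    rewrite (_ : [set` iota 0 n] = `I_n)//.
    by apply/seteqP; split=> i /=; rewrite mem_iota.
  pose A' i := if i == s then C else A i.
  have mA' i : measurable (A' i) by rewrite /A'; case: ifP.
  have AA' i : (i < s)%N -> A' i = A i by rewrite /A' => /ltn_eqF ->.
  have := indX (iota 0 s) A (iota_uniq _ _) mA; rewrite capE => ->.
  have := indX (iota 0 s.+1) A' (iota_uniq _ _) mA'; rewrite capE.
  have -> : \bigcap_(i in `I_s.+1) (X i @^-1` A' i) =
      \bigcap_(i in `I_s) (X i @^-1` A i) `&` X s @^-1` C.
    apply/seteqP; split=> x.
      move=> Ax; split=> [i /= iS|].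
        by rewrite -AA'//; exact: Ax (ltnW _).
      by have := Ax s (ltnSn s); rewrite /A' /= eqxx.
    move=> [Ax Cx] i /=; rewrite ltnS leq_eqVlt => /predU1P[->|iS].
      by rewrite /A' eqxx.
    by rewrite AA'//; exact: Ax.
  move=> ->; rewrite -[s.+1]addn1 iotaD big_cat/= big_seq1 add0n.
  rewrite {2}/A' eqxx; congr (_ * _)%E.
  apply: eq_big_seq => i; rewrite mem_iota => /andP[_ iS].
  by rewrite AA'.
- by move=> _; rewrite /= /mrestr setTI -ge0_fin_numE.
Qed.

Section sgd_adapted.
Context {R : realType} {d : nat} {dT dZ : measure_display}
  {T : measurableType dT} {Z : measurableType dZ}.
Variables (f : 'rV[R]_d -> Z -> R) (L : R) (eta : nat -> R) (w0 : 'rV[R]_d).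
Variable X : nat -> T -> Z.
Hypothesis mf : forall w, measurable_fun setT (f w).
Hypothesis df : forall z w, differentiable (f^~ z) w.
Hypothesis L0 : 0 < L.
Hypothesis sf : forall z, smooth L (f^~ z).

(** [history t] stops just before [X t], so the iterate at time [t] is determined by the past while
    the sample that moves it is still fresh. *)
Lemma adapted_sgd t j : adapted X t (fun o => sgd f eta X w0 t o 0 j).
Proof.
elim: t j => [|t IH] j; first by rewrite /adapted /=; apply: measurable_cst.
rewrite /adapted (_ : (fun _ => _) = fun o => sgd f eta X w0 t o 0 j
    - eta t * grad (f^~ (X t o)) (sgd f eta X w0 t o) 0 j); last first.
  by apply/funext => o; rewrite /= !mxE.
apply: measurable_funB; first exact: (adapted_succ (IH _)).
apply: measurable_funM => //.
apply: (@measurable_caratheodory R d _ _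
  (g_sigma_algebraType (history X t.+1)) Z (fun w z => grad (f^~ z) w 0 j)).
- by move=> w; exact: measurable_grad.
- by move=> z; exact: continuous_grad (sf z).
- by move=> i; exact: (adapted_succ (IH _)).
- exact: adapted_history.
Qed.

End sgd_adapted.

(** * Maximal inequality *)

Section ville.
Local Open Scope ereal_scope.
Context {R : realType} {dT : measure_display} {T : measurableType dT}.
Variables (P : probability T R) (G : nat -> set (set T)) (Y : nat -> T -> R).
Hypothesis Gm : forall s, G s `<=` measurable.
Hypothesis Gsucc : forall s, <<s G s>> `<=` <<s G s.+1>>.
Hypothesis mY : forall s,
  @measurable_fun _ _ (g_sigma_algebraType (G s)) _ setT (Y s).
Hypothesis Y0 : forall s x, (0 <= Y s x)%R.
Hypothesis supermartingale : forall s A, <<s G s>> A ->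
  \int[P]_(x in A) (Y s.+1 x)%:E <= \int[P]_(x in A) (Y s x)%:E.

Let G_measurable s : <<s G s>> `<=` measurable.
Proof. exact: sub_sigma_measurable. Qed.

Let mYT s : measurable_fun setT (Y s).
Proof. by move=> _ B mB; apply: (@G_measurable s); exact: mY. Qed.

Let mYe s A : measurable_fun A (EFin \o Y s).
Proof. by apply/measurable_EFinP; exact: measurable_funTS. Qed.

Variable e : R.
Hypothesis e0 : (0 < e)%R.

Let over s := [set x | (e <= Y s x)%R].

Let over_G s : <<s G s>> (over s).
Proof.
rewrite -[over s]setTI (_ : over s = Y s @^-1` `[e, +oo[%classic).
  by apply: mY.
by apply/seteqP; split=> x /=; rewrite in_itv/= andbT.
Qed.

Let hit t n := \bigcup_(k in `I_n) over (t + k)%N.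

Let hitS t n : hit t n.+1 = hit t n `|` (~` hit t n `&` over (t + n)%N).
Proof.
rewrite setUIr setUv setTI; apply/seteqP; split=> x.
  move=> [k /=]; rewrite ltnS leq_eqVlt => /predU1P[->|kn] xk; first by right.
  by left; exists k.
by move=> [[k /= kn xk]|xn]; [exists k => //=; exact: ltnW|exists n => /=].
Qed.

Let hit_G t n : <<s G (t + n) >> (hit t n).
Proof.
elim: n => [|n IH].
  rewrite /hit II0 bigcup_set0.
  exact: (@measurable0 _ (g_sigma_algebraType (G (t + 0)%N))).
rewrite hitS setUIr setUv setTI addnS; apply: Gsucc.
exact: (@measurableU _ (g_sigma_algebraType (G (t + n)%N)) _ _ IH
  (@over_G (t + n)%N)).
Qed.

(** Optional stopping at the first passage above [e]: stopped mass counts [e], the rest still runs.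
    At each step the event not yet hit is split by [over (t + n)]: on it [Y >= e] pays for the new
    mass, off it the supermartingale property advances the time. *)
Let ville_finite t n :
  e%:E * P (hit t n) + \int[P]_(x in ~` hit t n) (Y (t + n) x)%:E <=
  \int[P]_x (Y t x)%:E.
Proof.
elim: n => [|n IH].
  by rewrite /hit II0 bigcup_set0 measure0 mule0 add0e setC0 addn0.
apply: le_trans IH.
have mhit : measurable (hit t n) by exact: G_measurable (@hit_G t n).
have mo : measurable (over (t + n)) by exact: G_measurable (@over_G (t + n)%N).
have mhitC := measurableC mhit.
have hitSC : ~` hit t n.+1 = ~` hit t n `\` over (t + n).
  by rewrite hitS setUIr setUv setTI setCU setDE.
rewrite -[X in _ <= _ + \int[_]_(_ in X) _](setUIDK _ (over (t + n)%N)).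
have mIo := measurableI _ _ mhitC mo.
rewrite (ge0_integral_setU P mIo (measurableD mhitC mo)); last 3 first.
- exact: mYe.
- by move=> x _; rewrite lee_fin.
- by rewrite disj_set2E setDE setIACA setICr setI0.
rewrite addeA; apply: leeD.
  rewrite hitS (measureU _ mhit mIo); last by rewrite setIA setICr set0I.
  rewrite ge0_muleDr// leeD2l//.
  rewrite -integral_cst//; apply: ge0_le_integral => //.
  - by move=> x _; rewrite lee_fin ltW.
  - exact: mYe.
  - by move=> x [_ xo]; rewrite lee_fin.
rewrite -hitSC addnS; apply: supermartingale.
rewrite hitSC.
apply: (@measurableD _ (g_sigma_algebraType (G (t + n)%N))) (@over_G (t + n)%N).
exact: (@measurableC _ (g_sigma_algebraType (G (t + n)%N)) _ (@hit_G t n)).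
Qed.

Lemma ville t : P (\bigcup_(s >= t) over s) <= e^-1%:E * \int[P]_x (Y t x)%:E.
Proof.
have -> : \bigcup_(s >= t) over s = \bigcup_n hit t n.
  apply/seteqP; split=> x.
    move=> [s /= ts xs]; exists (s - t).+1 => //; exists (s - t)%N => //=.
    by rewrite subnKC.
  by move=> [n _ [k _ xk]]; exists (t + k)%N => //=; exact: leq_addr.
have mhit n : measurable (hit t n) by exact: G_measurable (@hit_G t n).
have ndhit : nondecreasing_seq (hit t).
  move=> m n mn; apply/subsetPset => x [k /= km xk].
  by exists k => //=; exact: leq_trans mn.
have cvg := @nondecreasing_cvg_mu _ T R P _ mhit (bigcupT_measurable _ mhit)
  ndhit.
rewrite -(cvg_lim _ cvg)//; apply: lime_le.
  by apply/cvg_ex; eexists; exact: cvg.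
apply: nearW => n /=.
rewrite lee_pdivlMl//.
apply: le_trans (ville_finite t n); rewrite leeDl// integral_ge0// => x _.
by rewrite lee_fin.
Qed.

(** The limsup event lies in every union over [s >= t]. Choosing [t] with mean at most [e * c] makes
    the maximal inequality bound its probability by the arbitrary [c]. *)
Lemma supermartingale_lim_sup_set0 :
  (forall delta : R, (0 < delta)%R ->
     exists t, \int[P]_x (Y t x)%:E <= delta%:E) ->
  P (lim_sup_set over) = 0.
Proof.
move=> Ysmall; apply/eqP; rewrite eq_le measure_ge0 andbT.
apply/lee_addgt0Pr => c c0; rewrite add0e.
have [t Yt] := Ysmall (e * c)%R (mulr_gt0 e0 c0).
have mover s : measurable (over s) by exact: G_measurable (@over_G s).
apply: le_trans (lim_sup_set_ub _ t mover) _.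
apply: le_trans (ville t) _.
by rewrite lee_pdivrMl// -EFinM.
Qed.

End ville.

(** * Smallness of the means from divergence of the step sizes *)

Section decay.
Context {R : realType}.
Variables (eta : nat -> R).
Hypothesis eta0 : forall t, 0 <= eta t.

Definition sqtail t : R := fine (\sum_(t <= k <oo) (eta k ^+ 2)%:E)%E.

Hypothesis sq_fin : (\sum_(0 <= t <oo) (eta t ^+ 2)%:E < +oo)%E.

Let sq0 k : (0 <= (eta k ^+ 2)%:E)%E. Proof. by rewrite lee_fin sqr_ge0. Qed.

Let tail_fin t : (\sum_(t <= k <oo) (eta k ^+ 2)%:E)%E \is a fin_num.
Proof.
rewrite ge0_fin_numE; last by apply: nneseries_ge0 => k _ _.
apply: le_lt_trans sq_fin.
have := @nneseries_split R (fun k => (eta k ^+ 2)%:E) 0 t (fun k _ => sq0 k).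
rewrite add0n => ->; rewrite leeDr//; exact: sume_ge0.
Qed.

Lemma sqtail_ge0 t : 0 <= sqtail t.
Proof. by rewrite fine_ge0//; apply: nneseries_ge0 => k _ _. Qed.

Lemma sqtailS t : sqtail t = eta t ^+ 2 + sqtail t.+1.
Proof.
rewrite /sqtail (@nneseries_split R _ t 1)// addn1 big_nat1 fineD//.
Qed.

Lemma sqtail_cvg : sqtail t @[t --> \oo] --> 0.
Proof.
have := nneseries_tail_cvg sq_fin (fun k _ => sq0 k).
exact: (fine_cvg (a := 0)).
Qed.

Hypothesis sum_eta : (\sum_(0 <= t <oo) (eta t)%:E = +oo)%E.

(** Otherwise, once the tail term is below delta / 2, every [a t] is at least delta / 2. Then a t +
    K sqtail t drops by at least mu eta_t delta / 2 at each step; since it stays nonnegative, the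
    step sizes would have a finite sum. *)
Lemma decay (mu K : R) (a : nat -> R) : 0 < mu -> 0 <= K ->
  (forall t, 0 <= a t) ->
  (forall t, a t.+1 <= (1 - mu * eta t) * a t + eta t ^+ 2 * K) ->
  forall delta, 0 < delta -> exists t, a t + K * sqtail t <= delta.
Proof.
move=> mu0 K0 a0 rec delta delta0.
have [T0 _ tailT] : \forall t \near \oo, K * sqtail t < delta / 2.
  have : K * sqtail t @[t --> \oo] --> K * 0.
    by apply: cvgMr; exact: sqtail_cvg.
  rewrite mulr0 => /cvgr_lt; apply; exact: divr_gt0.
apply: contrapT => /forallNP big.
pose b t := a t + K * sqtail t.
have a_big t : (T0 <= t)%N -> delta / 2 <= a t.
  move=> /tailT /= tailt; rewrite leNgt; apply/negP => at_small.
  by apply: (big t); lra.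
have b_dec n :
    mu * (delta / 2) * \sum_(T0 <= k < T0 + n) eta k <= b T0 - b (T0 + n)%N.
  elim: n => [|n IH]; first by rewrite addn0 big_geq// mulr0 subrr.
  rewrite addnS big_nat_recr/= ?leq_addr//.
  have := rec (T0 + n)%N.
  have : K * sqtail (T0 + n) =
      K * eta (T0 + n)%N ^+ 2 + K * sqtail (T0 + n).+1.
    by rewrite sqtailS mulrDr.
  have := ler_wpM2l (mulr_ge0 (ltW mu0) (eta0 (T0 + n)))
    (a_big _ (leq_addr n T0)).
  rewrite mulrDr; move: IH; rewrite /b; lra.
pose C := \sum_(0 <= k < T0) eta k + b T0 / (mu * (delta / 2)).
have b0 t : 0 <= b t by rewrite addr_ge0// mulr_ge0// sqtail_ge0.
have md0 : 0 < mu * (delta / 2) by rewrite mulr_gt0// divr_gt0.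
suff : (\sum_(0 <= t <oo) (eta t)%:E <= C%:E)%E by rewrite sum_eta leye_eq.
apply: lime_le; first by apply: is_cvg_nneseries => k _ _; rewrite lee_fin.
near=> n.
have [m ->] : exists m, n = (T0 + m)%N.
  by exists (n - T0)%N; rewrite subnKC//; near: n; exact: nbhs_infty_ge.
rewrite sumEFin lee_fin (big_cat_nat (n := T0)) ?leq_addr//= lerD2l.
rewrite ler_pdivlMr// mulrC (le_trans (b_dec m))// lerBlDr lerDl//.
Unshelve. all: by end_near. Qed.

End decay.

(** * Almost sure convergence of the iterates *)

Theorem theorem1 (R : realType) (d : nat)
  (dO : measure_display) (Omega : measurableType dO) (P : probability Omega R)
  (dZ : measure_display) (Z : measurableType dZ) (xi : {RV P >-> Z})
  (dO' : measure_display) (Omega' : measurableType dO')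
  (P' : probability Omega' R) (xis : nat -> {RV P' >-> Z})
  (f : 'rV[R]_d -> Z -> R) (F : 'rV[R]_d -> R)
  (mu L : R) (w0 wstar : 'rV[R]_d) (eta : nat -> R) :
  (forall w, measurable_fun setT (f w)) ->
  (forall z w, differentiable (f^~ z) w) ->
  (forall w, has_mean P (fun o => f w (xi o)) (F w)) ->
  (forall w, differentiable F w) ->
  (forall w, has_vmean P (fun o => grad (f^~ (xi o)) w) (grad F w)) ->
  0 < mu -> strongly_convex mu F ->
  0 < L -> (forall z, smooth L (f^~ z)) ->
  (forall z, convex (f^~ z)) ->
  unique (minimizer F) wstar ->
  (2%:E * 'E_P[fun o => (enorm (grad (f^~ (xi o)) wstar) ^+ 2)%R] < +oo)%E ->
  iid_copies xi xis ->
  (forall t, 0 < eta t <= 1 / (2 * L)) ->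
  (\sum_(0 <= t <oo) (eta t)%:E = +oo)%E ->
  (\sum_(0 <= t <oo) (eta t ^+ 2)%:E < +oo)%E ->
  {ae P', forall o,
    (fun t => enorm (sgd f eta (fun t => xis t : Omega' -> Z) w0 t o - wstar) ^+ 2)
      @ \oo --> (0 : R)}.
Proof.
move=> mf df Ff dF gF mu0 sc L0 sf cf [minF _] Efin [indX distX] eta_b sum_eta
  sum_sq.
pose X t := (xis t : Omega' -> Z).
pose w t o := sgd f eta X w0 t o.
pose D t o := dotr (w t o - wstar) (w t o - wstar).
have eta0 t : 0 <= eta t by have /andP[/ltW] := eta_b t.
have mX i : measurable_fun setT (X i) by exact: measurable_funP.
have Gm t := history_measurable mX t.
have mw t j : adapted X t (fun o => w t o 0 j).
  exact: (@adapted_sgd _ _ _ _ _ _ f L eta w0 X mf df L0 sf).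
have mDG t : adapted X t (D t).
  have mwB j : adapted X t (fun o => (w t o - wstar) 0 j).
    rewrite /adapted (_ : (fun _ => _) = fun o => w t o 0 j - wstar 0 j).
      by apply: measurable_funB; [exact: mw|].
    by apply/funext => o; rewrite !mxE.
  exact: measurable_dotr.
have mD t : measurable_fun setT (D t).
  by move=> _ B mB; apply: (sub_sigma_measurable (Gm t)); exact: mDG.
have [s gs] : exists s, has_mean P
    (fun o => dotr (grad (f^~ (xi o)) wstar) (grad (f^~ (xi o)) wstar)) s.
  apply: ge0_has_mean.
  - have mg j : measurable_fun setT (fun o => grad (f^~ (xi o)) wstar 0 j).
      apply: (@measurableT_comp _ _ _ _ _ _
        (fun z => grad (f^~ z) wstar 0 j)) => //.
      exact: measurable_grad.
    exact: measurable_dotr.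
  - by move=> o; exact: dotr_ge0.
  - rewrite (_ : (fun _ => _) =
        fun o => enorm (grad (f^~ (xi o)) wstar) ^+ 2); last first.
      by apply/funext => o; rewrite sqr_enorm.
    move: Efin; case: ('E_P[_])%E => [x _||//]; first by rewrite ltry.
    by rewrite mulry gtr0_sg// mul1e.
have s0 : 0 <= s.
  have /has_meanE[_ Es] := gs; rewrite -lee_fin -Es.
  by apply: integral_ge0 => o _; rewrite lee_fin dotr_ge0.
pose h t := sqdist_step f (eta t) wstar.
pose phi t := sqdist_bound mu (eta t) s wstar.
have h_mean t v : (\int[distribution P xi]_z (h t v z)%:E <= (phi t v)%:E)%E.
  exact: (sgd_step_mean mf df Ff dF gF sc L0 sf cf minF gs).
(* [phi] dominates the integral of a nonnegative function, which settles its sign without examining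
   [1 - mu * eta t]. *)
have phi0 t v : 0 <= phi t v.
  rewrite -lee_fin (le_trans _ (h_mean t v))//.
  by apply: integral_ge0 => z _; rewrite lee_fin dotr_ge0.
(* [D t.+1 o] is by definition [h t (w t o) (X t o)], where [w t] is determined by the past and
   [X t] is independent of it with the law of [xi]. *)
have step t A : <<s history X t >> A ->
    (\int[P']_(o in A) (D t.+1 o)%:E <= \int[P']_(o in A) (phi t (w t o))%:E)%E.
  apply: (@integral_indep_le R d _ _ _ _ P' (distribution P xi) (history X t)
    (X t) (Gm t) (mX t) _ (w t) (h t) (phi t)) => //.
  - move=> B C GB mC; have := indep_history (s := t) indX GB mC => /= ->.
    by congr (_ * _)%E; exact: distX.
  - exact: mw.
  - by move=> v; exact: (measurable_sqdist_step wstar mf df (eta t) v).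
  - by move=> z; exact: (continuous_sqdist_step L0 (sf z)).
  - by move=> v z; exact: dotr_ge0.
  - exact: continuous_sqdist_bound.
have phi_mean t a : has_mean P' (D t) a ->
    has_mean P' (fun o => phi t (w t o))
      ((1 - mu * eta t) * a + eta t ^+ 2 * (2 * s)).
  move=> Da; apply: has_meanD; last exact: has_mean_cst.
  exact: has_meanZ.
have EDS t a : has_mean P' (D t) a ->
    ('E_P'[D t.+1] <= ((1 - mu * eta t) * a + eta t ^+ 2 * (2 * s))%:E)%E.
  move=> /phi_mean/has_meanE[_ <-]; rewrite expectation.unlock; apply: step.
  exact: (@measurableT _ (g_sigma_algebraType (history X t))).
(* Finiteness of the means propagates by induction from the constant [D 0], since the bound in [EDS]
   is a real number. *)
have /choice[a Da] t : exists a, has_mean P' (D t) a.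
  elim: t => [|t [a Da]].
    pose c := dotr (w0 - wstar) (w0 - wstar).
    by exists c; exact: (has_mean_cst P' c).
  apply: ge0_has_mean => //; first by move=> o; exact: dotr_ge0.
  by apply: le_lt_trans (EDS _ _ Da) _; rewrite ltry.
have a0 t : 0 <= a t.
  have /has_meanE[_ Ea] := Da t; rewrite -lee_fin -Ea.
  by apply: integral_ge0 => o _; rewrite lee_fin dotr_ge0.
have arec t : a t.+1 <= (1 - mu * eta t) * a t + eta t ^+ 2 * (2 * s).
  have [_ Ea] := Da t.+1; rewrite -lee_fin -Ea; exact: EDS.
pose K := 2 * s; have K0 : 0 <= K by rewrite mulr_ge0.
pose r t := K * sqtail eta t.
have r0 t : 0 <= r t by rewrite mulr_ge0// sqtail_ge0.
pose Y t o := D t o + r t.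
have mY t : adapted X t (Y t) by apply: measurable_funD; [exact: mDG|].
have Y0 t o : 0 <= Y t o by rewrite addr_ge0// dotr_ge0.
have super t A : <<s history X t >> A ->
    (\int[P']_(o in A) (Y t.+1 o)%:E <= \int[P']_(o in A) (Y t o)%:E)%E.
  move=> GA; have mA := sub_sigma_measurable (Gm t) GA.
  have mphi : measurable_fun setT (fun o => phi t (w t o)).
    have /has_meanE[/measurable_int + _] := phi_mean _ _ (Da t).
    by move/measurable_EFinP.
  have mDA t' : measurable_fun A (EFin \o D t').
    by apply/measurable_EFinP; exact: measurable_funTS.
  have mphiA : measurable_fun A (fun o => (phi t (w t o))%:E).
    by apply/measurable_EFinP; exact: measurable_funTS.
  under eq_integral do rewrite EFinD.
  rewrite ge0_integralD//; last 3 first.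
  - by move=> o _; rewrite lee_fin dotr_ge0.
  - exact: mDA.
  - by move=> o _; rewrite lee_fin.
  apply: (@le_trans _ _
    (\int[P']_(o in A) ((phi t (w t o))%:E + (r t.+1)%:E))%E).
    rewrite ge0_integralD//; last 2 first.
    - by move=> o _; rewrite lee_fin.
    - by move=> o _; rewrite lee_fin.
    by rewrite leeD2r//; exact: step.
  apply: ge0_le_integral => //.
  - by move=> o _; rewrite -EFinD lee_fin addr_ge0.
  - by apply: emeasurable_funD.
  - by apply/measurable_EFinP; apply: measurable_funTS; exact: measurable_funD.
  - move=> o _; rewrite -EFinD lee_fin /phi /sqdist_bound /Y -/(D t o) -/K /r.
    (* The noise term [K * eta t ^+ 2] is exactly the drop from [r t] to [r t.+1], so only the
       nonnegative contraction term [mu * eta t * D t o] is discarded. *)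
    rewrite (sqtailS sum_sq t) mulrDr.
    have : 0 <= mu * eta t * D t o by rewrite mulr_ge0 ?mulr_ge0 ?dotr_ge0// ltW.
    lra.
have Ysmall delta : 0 < delta ->
    exists t, (\int[P']_o (Y t o)%:E <= delta%:E)%E.
  move=> /(decay eta0 sum_sq sum_eta mu0 K0 a0 arec)[t td]; exists t.
  have /has_meanE[_ ->] := has_meanD (Da t) (has_mean_cst P' (r t)).
  by rewrite lee_fin.
(* The thresholds 1 / (m + 1) reduce all positive levels to a countable union of null events. *)
pose bad m := lim_sup_set (fun t => [set o | m.+1%:R^-1 <= Y t o]).
have mbad m : measurable (bad m).
  apply: bigcap_measurable => // n _; apply: bigcup_measurable => t _.
  apply: (sub_sigma_measurable (Gm t)).
  rewrite -[X in <<s _ >> X]setTI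
    (_ : [set o | m.+1%:R^-1 <= Y t o] = Y t @^-1` `[m.+1%:R^-1, +oo[%classic).
    exact: mY.
  by apply/seteqP; split=> o /=; rewrite in_itv/= andbT.
have Pbad m : P' (bad m) = 0%E.
  apply: (@supermartingale_lim_sup_set0 _ _ _ P' (history X) Y) => //.
  by move=> t; exact: history_succ.
have nbad : P'.-negligible (\bigcup_m bad m).
  apply: negligible_bigcup => m; exists (bad m); split=> //; exact: Pbad.
suff nconv : P'.-negligible
    (~` [set o | enorm (w t o - wstar) ^+ 2 @[t --> \oo] --> (0 : R)]).
  exact: nconv.
(* Outside that union [Y], and hence the smaller [D], is eventually below each 1 / (m + 1). *)
apply: negligibleS nbad => o /=; apply: contra_notP => good.
apply/cvgrPdist_lt => e e0.
have [m _ me] := near_infty_natSinv_lt (PosNum e0).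
have [n good_n] : exists n, forall t, (n <= t)%N -> Y t o < m.+1%:R^-1.
  apply: contrapT => /forallNP nexists; apply: good; exists m => // n _.
  have := nexists n => /existsNP[t /not_implyP[nt /negP]].
  by rewrite -leNgt => tY; exists t.
exists n => // t /= nt.
rewrite sub0r normrN sqr_enorm ger0_norm ?dotr_ge0//.
apply: le_lt_trans (lt_trans (good_n t nt) (me m (leqnn m))).
by rewrite /Y lerDl.
Qed.
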